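(* Let $k$ be an algebraically closed field of characteristic zero and let $f(x,y,z,t)\in k[x,y,z,t]$ be a nonsingular quartic form. Then $|\mathrm{Paut}(f)|$ is divisible by $7$ if and only if $f$ is projectively equivalent to $$f^{\lambda}=x^3y+y^3z+z^3x+t^4+\lambda xyzt$$ for some $\lambda\in k$ such that $\lambda^4\neq 4^4$.
   Context: A quartic form is a homogeneous polynomial of degree $4$. A nonzero form $f$ in four variables is nonsingular if the projective algebraic set $V_p(f)\subset\mathbf{P}^3(k)$ is nonsingular. For $A\in GL_4(k)$, $f_{A^{-1}}$ denotes the form $v\mapsto f(Av)$, and $(A)$ is the class of $A$ in $PGL_4(k)$. For polynomials, $f\sim g$ means $f=cg$ for some $c\in k^*$. $\mathrm{Paut}(f)=\{(A)\in PGL_4(k): f_{A^{-1}}\sim f\}$; it is a finite group when $f$ is nonsingular of degree $\geq 3$. Two forms $f,g$ are projectively equivalent if $f_{T^{-1}}\sim g$ for some $T\in GL_4(k)$. *)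

(* Defs.v *)
From HB Require Import structures.
From mathcomp Require Import all_boot all_order all_algebra.
From mathcomp Require Import mpoly.
From mathcomp Require Import boolp classical_sets functions cardinality.

Set Implicit Arguments.
Unset Strict Implicit.
Unset Printing Implicit Defensive.

Import GRing.Theory.
Local Open Scope ring_scope.
Local Open Scope quotient_scope.
Local Open Scope classical_set_scope.

Section Forms.
Variables (k : fieldType) (n : nat).
Implicit Types (f g : {mpoly k[n]}).

Definition proportional f g : Prop := exists2 c : k, c != 0 & f = c *: g.

(* The polynomial v |-> f(Av), written f_{A^-1} in the source. *)
Definition lin_subst f (A : 'M[k]_n) : {mpoly k[n]} :=
  f \mPo [tuple \sum_(j < n) A i j *: 'X_j | i < n].

(* A point of P^(n-1)(k) is given by a nonzero vector of homogeneous
   coordinates.  The hypersurface is the one defined by the form f itself, not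
   by its radical: for instance the square of a quadratic form is singular at
   each of its zeros. *)
Definition singular_at f (v : 'I_n -> k) : Prop :=
  f.@[v] = 0 /\ forall i : 'I_n, (f^`M(i)).@[v] = 0.

Definition nonsingular f : Prop :=
  f != 0 /\ forall v : 'I_n -> k, (exists i, v i != 0) -> ~ singular_at f v.

Record GL : Type := MkGL { GLmx :> 'M[k]_n; _ : GLmx \in unitmx }.
HB.instance Definition _ := [isSub for GLmx].
HB.instance Definition _ := [Choice of GL by <:].

Definition proj_equiv f g : Prop :=
  exists T : GL, proportional (lin_subst f T) g.

Definition same_class (A B : GL) : bool :=
  `[< exists2 c : k, c != 0 & GLmx A = c *: GLmx B >].

Lemma same_class_refl : ssrbool.reflexive same_class.
Proof. by move=> A; apply/asboolP; exists 1; rewrite ?oner_neq0 ?scale1r. Qed.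

Lemma same_class_sym : ssrbool.symmetric same_class.
Proof.
suff H A B : same_class A B -> same_class B A by move=> A B; apply/idP/idP; apply: H.
move=> /asboolP[c c0 eAB]; apply/asboolP; exists c^-1; first by rewrite invr_eq0.
by rewrite eAB scalerA mulVf // scale1r.
Qed.

Lemma same_class_trans : ssrbool.transitive same_class.
Proof.
move=> B A C /asboolP[c c0 eAB] /asboolP[d d0 eBC]; apply/asboolP.
by exists (c * d); rewrite ?mulf_neq0 // eAB eBC scalerA.
Qed.

Canonical same_class_equiv :=
  EquivRel same_class same_class_refl same_class_sym same_class_trans.

Definition PGL : Type := {eq_quot same_class_equiv}.
HB.instance Definition _ := Choice.on PGL.
HB.instance Definition _ := Quotient.on PGL.

Definition Paut f : set PGL :=
  [set \pi_PGL A | A in [set A : GL | proportional (lin_subst f A) f]].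

End Forms.

Section Quartics.
Variable k : fieldType.

Definition quartic_family (lambda : k) : {mpoly k[4]} :=
  let x := 'X_(@Ordinal 4 0 isT) in
  let y := 'X_(@Ordinal 4 1 isT) in
  let z := 'X_(@Ordinal 4 2 isT) in
  let t := 'X_(@Ordinal 4 3 isT) in
  x ^+ 3 * y + y ^+ 3 * z + z ^+ 3 * x + t ^+ 4 + lambda *: (x * y * z * t).

End Quartics.

(* S is finite and the number of its elements is divisible by d. *)
Definition card_divisible_by (d : nat) (T : Type) (S : set T) : Prop :=
  exists2 m : nat, (S #= `I_m)%card & (d %| m)%N.

(* Main.v *)
(** An element of order 7 of [Paut f] lifts to a matrix [A] with [A ^+ 7 = 1]
    fixing [f], and is diagonalizable with eigenvalues [d_i].  Nonsingularity at
    the vertex [e_i] forces a monomial [x_i^3 x_j] in [f], so the set of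
    eigenvalues is stable under [d |-> d^4]; up to order they are
    [(w, w^4, w^2, b)] with [b = 1] or [b = w].  If [b = w] then [f] is singular
    on the line [y = z = 0]; if [b = 1] only the five monomials of [f^lambda]
    occur and a diagonal change of coordinates finishes.

    Conversely [diag (w, w^4, w^2, 1)] has order 7, and only the finiteness of
    the group is at stake.  The partial derivatives of [g = f^lambda] have no
    linear syzygy, so the stabilizer of [g] has trivial tangent space at 1; hence
    some polynomial function [h] on matrices satisfies [h 1 != 0] and vanishes on
    the stabilizer outside 1.  The kernel [h (P^-1 A)] has finite rank and
    is diagonal on the stabilizer, which bounds the number of its elements. *)
Require Import Defs.
From HB Require Import structures.
From mathcomp Require Import all_boot all_order all_algebra.
From mathcomp Require Import fingroup perm cyclic pgroup generic_quotient.
From mathcomp Require Import mpoly.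
From mathcomp Require Import ring zify finmap.
From mathcomp Require Import boolp classical_sets functions cardinality.

Set Implicit Arguments.
Unset Strict Implicit.
Unset Printing Implicit Defensive.

Import GRing.Theory.
Local Open Scope ring_scope.
Local Open Scope quotient_scope.

(** * Kernels of finite rank *)

Section FiniteRank.
Variables (k : fieldType) (S T : Type).

(** The image of the tensor product of the functions on [S] with those on [T]. It is closed under
    sums and products, hence under polynomial expressions and determinants. *)
Definition finite_rank (K : S -> T -> k) : Prop :=
  exists (I : finType) (a : I -> S -> k) (b : I -> T -> k),
    forall s t, K s t = \sum_i a i s * b i t.

Lemma finite_rank_ext (K L : S -> T -> k) :
  (forall s t, K s t = L s t) -> finite_rank L -> finite_rank K.
Proof. by move=> KL [I [a [b E]]]; exists I, a, b => s t; rewrite KL E. Qed.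

Lemma finite_rank_left (a : S -> k) : finite_rank (fun s _ => a s).
Proof.
by exists unit, (fun _ => a), (fun _ _ => 1) => s t; rewrite big_const card_unit /= addr0 mulr1.
Qed.

Lemma finite_rank_right (b : T -> k) : finite_rank (fun _ t => b t).
Proof.
by exists unit, (fun _ _ => 1), (fun _ => b) => s t; rewrite big_const card_unit /= addr0 mul1r.
Qed.

Lemma finite_rankD (K L : S -> T -> k) :
  finite_rank K -> finite_rank L -> finite_rank (fun s t => K s t + L s t).
Proof.
move=> [I [a [b E]]] [J [c [d F]]].
exists (I + J)%type, (fun i s => match i with inl i => a i s | inr j => c j s end),
  (fun i t => match i with inl i => b i t | inr j => d j t end) => s t.
by rewrite E F big_sumType.
Qed.

Lemma finite_rankM (K L : S -> T -> k) :
  finite_rank K -> finite_rank L -> finite_rank (fun s t => K s t * L s t).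
Proof.
move=> [I [a [b E]]] [J [c [d F]]].
exists (I * J)%type, (fun i s => a i.1 s * c i.2 s), (fun i t => b i.1 t * d i.2 t) => s t.
rewrite E F big_distrlr pair_bigA; apply: eq_bigr => -[i j] _ /=; ring.
Qed.

Lemma finite_rank_sum (I : Type) (r : seq I) (K : I -> S -> T -> k) :
  (forall i, finite_rank (K i)) -> finite_rank (fun s t => \sum_(i <- r) K i s t).
Proof.
move=> H; elim: r => [|i r IH].
  by apply: (finite_rank_ext (L := fun _ _ => 0)) (finite_rank_left _) => s t; rewrite big_nil.
by apply: finite_rank_ext (finite_rankD (H i) IH) => s t; rewrite big_cons.
Qed.

Lemma finite_rank_prod (I : Type) (r : seq I) (K : I -> S -> T -> k) :
  (forall i, finite_rank (K i)) -> finite_rank (fun s t => \prod_(i <- r) K i s t).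
Proof.
move=> H; elim: r => [|i r IH].
  by apply: (finite_rank_ext (L := fun _ _ => 1)) (finite_rank_left _) => s t; rewrite big_nil.
by apply: finite_rank_ext (finite_rankM (H i) IH) => s t; rewrite big_cons.
Qed.

Lemma finite_rank_det (n : nat) (M : S -> T -> 'M[k]_n) :
  (forall i j, finite_rank (fun s t => M s t i j)) ->
  finite_rank (fun s t => \det (M s t)).
Proof.
move=> H; apply: finite_rank_sum => p; apply: finite_rankM; first exact: finite_rank_left.
by apply: finite_rank_prod.
Qed.

(** The matrix of the values [K (s i) (t j)] is diagonal and invertible of size [n], yet factors
    through a space of dimension [#|I|]. *)
Lemma finite_rank_diagonal (K : S -> T -> k) : finite_rank K ->
  exists r, forall (n : nat) (s : 'I_n -> S) (t : 'I_n -> T),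
    (forall i j, (K (s i) (t j) == 0) = (i != j)) -> (n <= r)%N.
Proof.
move=> [I [a [b E]]]; exists #|I| => n s t H.
pose A := \matrix_(i < n, j < #|I|) a (enum_val j) (s i).
pose B := \matrix_(j < #|I|, i < n) b (enum_val j) (t i).
pose d := \row_(i < n) K (s i) (t i).
have AB : A *m B = diag_mx d.
  apply/matrixP => i j; rewrite !mxE (reindex (@enum_rank I)) /=; last first.
    by apply/onW_bij/enum_rank_bij.
  under eq_bigr do rewrite !mxE enum_rankK.
  rewrite -E; case: (eqVneq i j) => [->|nij]; first by rewrite mulr1n.
  by rewrite mulr0n; apply/eqP; rewrite H.
have uD : diag_mx d \in unitmx.
  rewrite unitmxE det_diag unitfE; apply/prodf_neq0 => i _.
  by rewrite mxE H eqxx.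
by rewrite -(mxrank_unit uD) -AB; apply: leq_trans (mxrankM_maxr _ _) (rank_leq_row _).
Qed.

End FiniteRank.

(** No nonzero column is killed by all the rows [L v], so these rows span and a basis can be picked
    among them, one row at a time. *)
Lemma functional_basis (k : fieldType) (V : Type) (n : nat) (L : V -> 'rV[k]_n) :
  (forall b : 'cV[k]_n, (forall v, L v *m b = 0) -> b = 0) ->
  exists s : 'I_n -> V, (\matrix_i L (s i)) \in unitmx.
Proof.
move=> H.
suff: forall r, (r <= n)%N -> exists s : 'I_r -> V, row_free (\matrix_i L (s i)).
  by move=> /(_ n (leqnn n)) [s]; rewrite row_free_unit => ?; exists s.
elim=> [_|r IH lt_rn].
  have s : 'I_0 -> V by case.
  by exists s; rewrite /row_free -leqn0 rank_leq_row.
have [s fs] := IH (ltnW lt_rn); set M := \matrix_i L (s i) in fs.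
(* If every [L v] lay in the row space of [M], all columns of [cokermx M] would vanish by [H], and
   [M], with only [r] rows, would have rank [n]. *)
have [v nv] : exists v, ~ (L v <= M)%MS.
  apply: contrapT => /forallNP sM.
  have : cokermx M = 0.
    apply/matrixP => i j; rewrite [RHS]mxE.
    suff -> : cokermx M = \matrix_(i, j) (col j (cokermx M)) i 0.
      rewrite mxE (H (col j (cokermx M))) ?mxE // => v.
      have /contrapT := sM v; rewrite submxE => /eqP E.
      by rewrite colE mulmxA E mul0mx.
    by apply/matrixP => ? ?; rewrite !mxE.
  move=> /eqP; rewrite -mxrank_eq0 mxrank_coker subn_eq0 => le.
  by move: (leq_trans le (rank_leq_row M)); rewrite leqNgt lt_rn.
exists (fun i : 'I_r.+1 => oapp s v (unlift ord_max i)).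
set N := \matrix_i _.
have MN : (M + L v <= N)%MS.
  rewrite addsmx_sub; apply/andP; split.
    apply/row_subP => i; have -> : row i M = row (lift ord_max i) N.
      by rewrite !rowK liftK.
    exact: row_sub.
  have -> : L v = row ord_max N by rewrite rowK unlift_none.
  exact: row_sub.
rewrite /row_free eqn_leq rank_leq_row; apply: leq_trans (mxrankS MN).
have lt : (M < M + L v)%MS.
  rewrite ltmxE addsmxSl; apply/negP => sub; apply: nv.
  by apply: submx_trans sub; exact: addsmxSr.
by move: (rank_ltmx lt); rewrite (eqP fs).
Qed.

(** Cauchy's theorem one way, Lagrange's the other. The operation is an argument, so that the result
    applies to the finite subset [Paut f] of [PGL]; [iter p (mul a) e] is the p-th power of [a]. *)
Lemma card_iter_prime (T : finType) (mul : T -> T -> T) (e : T) (inv : T -> T) (p : nat) :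
  associative mul -> left_id e mul -> left_inverse e inv mul -> prime p ->
  (p %| #|T|)%N <-> exists2 a, a != e & iter p (mul a) e = e.
Proof.
case: T mul e inv => T [m1 m2 m3 m4] mul e inv mulA mul1 mulV p_pr.
pose fT : finType := HB.pack T m1 m2 m3 m4.
pose gT : finGroupType := HB.pack T fT (Finite_isGroup.Build fT mulA mul1 mulV).
have itE (a : gT) n : iter n (mul a) e = (a ^+ n)%g.
  by elim: n => [|n IH] //; rewrite expgS -IH.
split=> [dv|[a na]].
  have [|a _ oa] := @Cauchy gT p [set: gT]%G p_pr; first by rewrite cardsT.
  exists a; last by rewrite itE -oa expg_order.
  by apply/eqP => ae; move: oa p_pr; rewrite ae order1 => <-.
rewrite itE => ap.
have /(prime_nt_dvdP p_pr) oa : (#[a : gT]%g %| p)%N by rewrite order_dvdn; apply/eqP.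
rewrite -oa; first by rewrite -(cardsT gT); apply: order_dvdG; rewrite inE.
by rewrite order_eq1.
Qed.

(** * Linear substitutions and the group PGL *)

Section LinearSubstitution.
Variables (k : fieldType) (n : nat).
Implicit Types (f g : {mpoly k[n]}) (A B : 'M[k]_n) (v : 'I_n -> k).

Definition mxapp A v : 'I_n -> k := fun i => \sum_j A i j * v j.

Lemma mxappM A B v : mxapp (A *m B) v = mxapp A (mxapp B v).
Proof.
apply: funext => i; rewrite /mxapp.
under eq_bigr do rewrite mxE mulr_suml.
rewrite exchange_big; apply: eq_bigr => j _ /=.
by rewrite mulr_sumr; apply: eq_bigr => l _; rewrite mulrA.
Qed.

Lemma mxapp1 v : mxapp 1%:M v = v.
Proof.
apply: funext => i; rewrite /mxapp (bigD1 i) //= mxE eqxx mul1r big1 ?addr0 // => j ji.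
by rewrite mxE eq_sym (negbTE ji) mul0r.
Qed.

Lemma meval_lin_subst f A v : (lin_subst f A).@[v] = f.@[mxapp A v].
Proof.
rewrite /lin_subst comp_mpoly_meval; apply: meval_eq => i.
by rewrite tnth_mktuple raddf_sum; apply: eq_bigr => j _; rewrite /= mevalZ mevalXU.
Qed.

Lemma mpoly_ring_ind (P : {mpoly k[n]} -> Prop) :
  (forall c, P c%:MP) -> (forall i, P 'X_i) ->
  (forall f g, P f -> P g -> P (f + g)) -> (forall f g, P f -> P g -> P (f * g)) ->
  forall f, P f.
Proof.
move=> PC PX PD PM f; rewrite [f]mpolyE.
apply: (big_ind P) => // [|m _]; first by rewrite -mpolyC0.
rewrite -mul_mpolyC; apply: (PM) => //; rewrite mpolyXE_id.
have P1 : P 1 by rewrite -[1]/(1%:MP).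
apply: big_rec => // i q _ Pq; apply: (PM) => //.
elim: (m i) => [|e IH]; first by rewrite expr0.
by rewrite exprS; apply: (PM).
Qed.

Lemma lin_substX i A : lin_subst 'X_i A = \sum_j A i j *: 'X_j.
Proof. by rewrite /lin_subst comp_mpolyXU -tnth_nth tnth_mktuple. Qed.

Lemma lin_substC c A : lin_subst c%:MP A = c%:MP.
Proof. exact: comp_mpolyC. Qed.

Lemma lin_substD f g A : lin_subst (f + g) A = lin_subst f A + lin_subst g A.
Proof. exact: raddfD. Qed.

Lemma lin_substZ c f A : lin_subst (c *: f) A = c *: lin_subst f A.
Proof. exact: comp_mpolyZ. Qed.

Lemma lin_subst_prod f g A : lin_subst (f * g) A = lin_subst f A * lin_subst g A.
Proof. exact: rmorphM. Qed.

Lemma lin_subst_mulmx f A B : lin_subst (lin_subst f A) B = lin_subst f (A *m B).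
Proof.
elim/mpoly_ring_ind: f => [c|i|f g IHf IHg|f g IHf IHg].
- by rewrite !lin_substC.
- rewrite !lin_substX /lin_subst raddf_sum /=.
  under eq_bigr => j _ do rewrite comp_mpolyZ -/(lin_subst _ _) lin_substX scaler_sumr.
  rewrite exchange_big; apply: eq_bigr => l _ /=.
  by rewrite mxE scaler_suml; apply: eq_bigr => j _; rewrite scalerA.
- by rewrite !lin_substD IHf IHg.
- by rewrite !lin_subst_prod IHf IHg.
Qed.

Lemma lin_subst1 f : lin_subst f 1%:M = f.
Proof.
elim/mpoly_ring_ind: f => [c|i|f g IHf IHg|f g IHf IHg].
- by rewrite lin_substC.
- rewrite lin_substX (bigD1 i) //= mxE eqxx scale1r big1 ?addr0 // => j ji.
  by rewrite mxE eq_sym (negbTE ji) scale0r.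
- by rewrite lin_substD IHf IHg.
- by rewrite lin_subst_prod IHf IHg.
Qed.

Lemma lin_subst_eq0 f A : A \in unitmx -> (lin_subst f A == 0) = (f == 0).
Proof.
move=> uA; apply/eqP/eqP => [e|->]; last exact: raddf0.
by rewrite -(lin_subst1 f) -(mulmxV uA) -lin_subst_mulmx e /lin_subst raddf0.
Qed.

Lemma lin_subst_diag_monomial m (d : 'rV[k]_n) :
  lin_subst 'X_[m] (diag_mx d) = (\prod_i d 0 i ^+ m i) *: 'X_[m].
Proof.
rewrite /lin_subst comp_mpolyX [X in _ = _ *: X]mpolyXE_id -scaler_prod.
apply: eq_bigr => i _; rewrite tnth_mktuple (bigD1 i) //= big1 ?addr0.
  by rewrite mxE eqxx mulr1n exprZn.
by move=> j ji; rewrite mxE eq_sym (negbTE ji) mulr0n scale0r.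
Qed.

Lemma mcoeff_lin_subst_diag f (d : 'rV[k]_n) m :
  (lin_subst f (diag_mx d))@_m = (\prod_i d 0 i ^+ m i) * f@_m.
Proof.
rewrite {1}[f]mpolyE /lin_subst (raddf_sum (comp_mpoly _)) raddf_sum /=.
under eq_bigr => m' _ do
  rewrite comp_mpolyZ -/(lin_subst _ _) lin_subst_diag_monomial !mcoeffZ mcoeffX.
have [fm|fm] := boolP (m \in msupp f).
  rewrite (bigD1_seq m) //= eqxx mulr1 [X in _ + X]big1 ?addr0; first by rewrite mulrC.
  by move=> m' /negbTE ->; rewrite !mulr0.
rewrite (memN_msupp_eq0 fm) mulr0 big1_seq // => m' /andP[_ m'f].
by case: eqP => [e|_]; [rewrite e (negbTE fm) in m'f | rewrite !mulr0].
Qed.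

Lemma lin_subst_scalemx f d c A : f \is d.-homog ->
  lin_subst f (c *: A) = c ^+ d *: lin_subst f A.
Proof.
move=> hf; have -> : c *: A = c%:M *m A by rewrite mul_scalar_mx.
rewrite -lin_subst_mulmx -lin_substZ; congr lin_subst; apply/mpolyP => m.
have -> : c%:M = diag_mx (const_mx c) :> 'M[k]_n by rewrite diag_const_mx.
rewrite mcoeff_lin_subst_diag mcoeffZ.
have [fm|fm] := boolP (m \in msupp f); last by rewrite (memN_msupp_eq0 fm) !mulr0.
under eq_bigr do rewrite mxE; rewrite prodrXr.
by have := dhomogP _ _ _ hf m fm; rewrite /= mdegE => <-.
Qed.

Lemma mderivXU (i j : 'I_n) : ('X_i)^`M(j) = (i == j)%:R%:MP :> {mpoly k[n]}.
Proof.
rewrite mderivX mnm1E; case: eqP => [->|_]; last by rewrite scale0r.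
have -> : (U_(j) - U_(j) = 0 :> 'X_{1..n})%MM.
  by apply/mnmP => l; rewrite mnmBE subnn mnm0E.
by rewrite mpolyX0 scale1r.
Qed.

Lemma mderiv_lin_subst f A j :
  (lin_subst f A)^`M(j) = \sum_i A i j *: lin_subst (f^`M(i)) A.
Proof.
elim/mpoly_ring_ind: f => [c|i|f g IHf IHg|f g IHf IHg].
- rewrite lin_substC mderivC big1 // => i _.
  by rewrite mderivC /lin_subst raddf0 scaler0.
- rewrite lin_substX raddf_sum /= (bigD1 j) //= big1 => [|l lj]; last first.
    by rewrite mderivZ mderivXU (negbTE lj) mpolyC0 scaler0.
  rewrite (bigD1 i) //= big1 => [|l li]; last first.
    by rewrite mderivXU eq_sym (negbTE li) lin_substC mpolyC0 scaler0.
  by rewrite !addr0 mderivZ !mderivXU !eqxx lin_substC.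
- rewrite lin_substD mderivD IHf IHg -big_split; apply: eq_bigr => i _ /=.
  by rewrite mderivD lin_substD scalerDr.
- rewrite lin_subst_prod mderivM IHf IHg mulr_suml mulr_sumr -big_split.
  apply: eq_bigr => i _ /=.
  by rewrite mderivM lin_substD !lin_subst_prod scalerDr scalerAl scalerAr.
Qed.

(** By the chain rule the gradient of the transformed form at [v] is the transpose of [A] applied to
    the gradient of [f] at [A v]; a singular point [v] would give the singular point [A v]. *)
Lemma nonsingular_lin_subst f A : A \in unitmx -> nonsingular f -> nonsingular (lin_subst f A).
Proof.
move=> uA [f0 nf]; split=> [|v [i vi] [fv dv]]; first by rewrite lin_subst_eq0.
apply: (nf (mxapp A v)).
  apply: contrapT => /forallNP Av0; move: vi.
  have -> : v = mxapp (invmx A) (mxapp A v) by rewrite -mxappM mulVmx // mxapp1.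
  rewrite {1}/mxapp big1 ?eqxx // => j _.
  by have /negP/negPn/eqP -> := Av0 j; rewrite mulr0.
split; first by rewrite -meval_lin_subst.
pose w : 'I_n -> k := fun j => (f^`M(j)).@[mxapp A v].
have wA : mxapp A^T w = fun=> 0.
  apply: funext => j; rewrite -[RHS](dv j) mderiv_lin_subst raddf_sum.
  by apply: eq_bigr => l _; rewrite /= mevalZ meval_lin_subst mxE.
have w0 : w = fun=> 0.
  rewrite -(mxapp1 w) -(@mulVmx _ _ A^T) ?unitmx_tr // mxappM wA.
  by apply: funext => l; rewrite /mxapp big1 // => ? _; rewrite mulr0.
by move=> j; rewrite -[LHS]/(w j) w0.
Qed.

End LinearSubstitution.

Section ProjectiveGroup.
Variables (k : fieldType) (n : nat).
Implicit Types (A B : GL k n) (f : {mpoly k[n]}) (a b : PGL k n).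

Lemma GLmx_unit A : GLmx A \in unitmx. Proof. by case: A. Qed.

Lemma pi_PGL_congr A B : GLmx A = GLmx B -> \pi_(PGL k n) A = \pi_(PGL k n) B.
Proof. by move=> AB; congr (\pi_(PGL k n) _); apply: val_inj. Qed.

Definition GLmul A B : GL k n :=
  MkGL (eq_ind_r is_true (introT andP (conj (GLmx_unit A) (GLmx_unit B))) (unitmx_mul A B)).
Definition GL1 : GL k n := MkGL (unitmx1 k n).
Definition GLinv A : GL k n :=
  MkGL (eq_ind_r is_true (GLmx_unit A) (unitmx_inv A)).

Lemma pi_PGL_eq A B : \pi_(PGL k n) A = \pi_(PGL k n) B <->
  exists2 c : k, c != 0 & GLmx A = c *: GLmx B.
Proof. by split=> [/eqmodP/asboolP|H] //; apply/eqmodP/asboolP. Qed.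

Definition PGLmul a b : PGL k n := \pi_(PGL k n) (GLmul (repr a) (repr b)).
Definition PGL1 : PGL k n := \pi GL1.
Definition PGLinv a : PGL k n := \pi_(PGL k n) (GLinv (repr a)).

Lemma repr_PGL A : exists2 c : k, c != 0 & GLmx (repr (\pi_(PGL k n) A)) = c *: GLmx A.
Proof. by apply/pi_PGL_eq; rewrite reprK. Qed.

Lemma PGLmul_pi A B : PGLmul (\pi_(PGL k n) A) (\pi B) = \pi_(PGL k n) (GLmul A B).
Proof.
apply/pi_PGL_eq; have [c c0 /= ->] := repr_PGL A; have [d d0 /= ->] := repr_PGL B.
by exists (c * d); rewrite ?mulf_neq0 // -scalemxAl -scalemxAr scalerA.
Qed.

Lemma PGLinv_pi A : PGLinv (\pi_(PGL k n) A) = \pi_(PGL k n) (GLinv A).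
Proof.
apply/pi_PGL_eq; have [c c0 /= ->] := repr_PGL A.
by exists c^-1; rewrite ?invr_eq0 // invmxZ // unitmxZ ?GLmx_unit // unitfE.
Qed.

Lemma PGL_ind (P : PGL k n -> Prop) : (forall A, P (\pi_(PGL k n) A)) -> forall a, P a.
Proof. by move=> H a; rewrite -(reprK a). Qed.

Lemma PGLmulA : associative PGLmul.
Proof.
elim/PGL_ind=> A; elim/PGL_ind=> B; elim/PGL_ind=> C; rewrite (PGLmul_pi B C) (PGLmul_pi A B).
rewrite (PGLmul_pi A (GLmul B C)) (PGLmul_pi (GLmul A B) C).
by apply: pi_PGL_congr; rewrite /= mulmxA.
Qed.

Lemma PGLmul1 : left_id PGL1 PGLmul.
Proof.
by elim/PGL_ind=> A; rewrite PGLmul_pi; congr (\pi_(PGL k n) _); apply: val_inj; rewrite /= mul1mx.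
Qed.

Lemma PGLmulV : left_inverse PGL1 PGLinv PGLmul.
Proof.
elim/PGL_ind=> A; rewrite PGLinv_pi PGLmul_pi; apply: pi_PGL_congr.
by rewrite /= mulVmx ?GLmx_unit.
Qed.

Lemma proportional_mul f (A B : 'M[k]_n) :
  proportional (lin_subst f A) f -> proportional (lin_subst f B) f ->
  proportional (lin_subst f (A *m B)) f.
Proof.
move=> [c c0 eA] [d d0 eB]; exists (c * d); first by rewrite mulf_neq0.
by rewrite -lin_subst_mulmx eA lin_substZ eB scalerA.
Qed.

Lemma proportional_inv f (A : 'M[k]_n) : A \in unitmx ->
  proportional (lin_subst f A) f -> proportional (lin_subst f (invmx A)) f.
Proof.
move=> uA [c c0 eA]; exists c^-1; first by rewrite invr_eq0.
apply: (canRL (scalerK c0)).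
by rewrite -lin_substZ -eA lin_subst_mulmx mulmxV // lin_subst1.
Qed.

(** Rescaling [A] by [e] multiplies the transformed form by [e ^+ d], so the condition depends only
    on the class of [A]. *)
Lemma Paut_pi f d A : f \is d.-homog ->
  Paut f (\pi_(PGL k n) A) <-> proportional (lin_subst f A) f.
Proof.
move=> hf; split=> [[B [c c0 eB]] /pi_PGL_eq [e e0 eBA]|]; last by exists A.
exists ((e ^+ d)^-1 * c); first by rewrite mulf_neq0 ?invr_eq0 ?expf_neq0.
rewrite -scalerA -eB eBA (lin_subst_scalemx _ _ hf) scalerA mulVf ?scale1r //.
by rewrite expf_neq0.
Qed.

End ProjectiveGroup.

Lemma Paut_card_prime (k : fieldType) (n : nat) (f : {mpoly k[n.+1]}) (d p m : nat) :
  f \is d.-homog -> prime p -> (Paut f #= `I_m)%card ->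
  (p %| m)%N <-> exists A : GL k n.+1,
    [/\ proportional (lin_subst f A) f, ~ (exists c, GLmx A = c%:M)
      & exists2 c, c != 0 & GLmx A ^+ p = c%:M].
Proof.
move=> hf p_pr Pm.
have /finite_fsetP [F PF] : finite_set (Paut f) by apply/finite_setP; exists m.
have {Pm} <- : #|`F| = m by apply/card_eq_fsetP; rewrite -PF.
have inF a : (a \in F) <-> Paut f a by rewrite PF.
(* [F] contains 1 and is closed under product and inverse, so it inherits the group laws of
   [PGL]. *)
have F1 : PGL1 k n.+1 \in F.
  by apply/inF/(Paut_pi _ hf); exists 1; rewrite ?oner_eq0 // lin_subst1 scale1r.
have FM (a b : F) : PGLmul (val a) (val b) \in F.
  case: a b => [a] /= + [b] /=; elim/PGL_ind: a => A /inF/(Paut_pi _ hf) fA.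
  elim/PGL_ind: b => B /inF/(Paut_pi _ hf) fB.
  by rewrite PGLmul_pi; apply/inF/(Paut_pi _ hf)/proportional_mul.
have FV (a : F) : PGLinv (val a) \in F.
  case: a => [a] /=; elim/PGL_ind: a => A /inF/(Paut_pi _ hf) fA.
  by rewrite PGLinv_pi; apply/inF/(Paut_pi _ hf)/proportional_inv; rewrite ?GLmx_unit.
have := @card_iter_prime F (fun a b => [` FM a b]%fset) [` F1]%fset (fun a => [` FV a]%fset) p.
rewrite cardfE => ->; first last.
- by [].
- by move=> a; apply: val_inj; apply: PGLmulV.
- by move=> a; apply: val_inj; apply: PGLmul1.
- by move=> a b c; apply: val_inj; apply: PGLmulA.
have itE (a : F) A : val a = \pi_(PGL k n.+1) A -> forall j, exists B : GL k n.+1,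
    val (iter j (fun b => [` FM a b]%fset) [` F1]%fset) = \pi_(PGL k n.+1) B
    /\ GLmx B = GLmx A ^+ j.
  move=> aA; elim=> [|j [B [IH BA]]]; first by exists (GL1 k n.+1).
  by exists (GLmul A B); rewrite /= IH aA PGLmul_pi exprS -BA.
split=> [[a na ap]|[A [fA nA [c c0 Ap]]]].
  have aA : val a = \pi_(PGL k n.+1) (repr (val a)) by rewrite reprK.
  have [B [Bp BA]] := itE a _ aA p.
  exists (repr (val a)); split.
  - by apply/(Paut_pi _ hf)/inF; rewrite reprK; apply: valP.
  - move=> [c eA]; case/eqP: na; apply: val_inj; rewrite aA; apply/pi_PGL_eq.
    exists c; last by rewrite eA scalemx1.
    apply: contraTneq (GLmx_unit (repr (val a))) => c0.
    by rewrite eA c0 raddf0 unitmxE det0 unitr0.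
  - move: Bp; rewrite ap /= => /esym/pi_PGL_eq[c c0 eB].
    by exists c; rewrite // -BA eB scalemx1.
have aF : \pi_(PGL k n.+1) A \in F by apply/inF/(Paut_pi _ hf).
exists [` aF]%fset.
  apply/eqP => /(congr1 val) /= /pi_PGL_eq[e _ eA]; apply: nA; exists e.
  by rewrite eA scalemx1.
have [B [Bp BA]] := itE [` aF]%fset A erefl p.
apply: val_inj; rewrite Bp /=; apply/pi_PGL_eq; exists c => //.
by rewrite BA Ap scalemx1.
Qed.

(** * Finiteness of the stabilizer of [f^lambda] *)

Notation o0 := (@Ordinal 4 0 isT).
Notation o1 := (@Ordinal 4 1 isT).
Notation o2 := (@Ordinal 4 2 isT).
Notation o3 := (@Ordinal 4 3 isT).

Lemma ord4P (P : 'I_4 -> Prop) : P o0 -> P o1 -> P o2 -> P o3 -> forall i, P i.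
Proof.
move=> P0 P1 P2 P3 [[|[|[|[|i]]]] lti] //.
- by rewrite (_ : Ordinal lti = o0) //; apply: val_inj.
- by rewrite (_ : Ordinal lti = o1) //; apply: val_inj.
- by rewrite (_ : Ordinal lti = o2) //; apply: val_inj.
- by rewrite (_ : Ordinal lti = o3) //; apply: val_inj.
Qed.

Lemma big_ord4 (R : Type) (idx : R) (op : Monoid.law idx) (F : 'I_4 -> R) :
  \big[op/idx]_(i < 4) F i = op (op (op (F o0) (F o1)) (F o2)) (F o3).
Proof.
rewrite !big_ord_recr big_ord0 Monoid.mul1m /=.
by congr (op (op (op (F _) (F _)) (F _)) (F _)); apply: val_inj.
Qed.

Definition vec4 (k : nzRingType) (x y z t : k) : 'I_4 -> k := fun i => [:: x; y; z; t]`_i.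

Lemma char0_natr_eq0 (k : fieldType) : [pchar k] =i pred0 ->
  forall n, ((n%:R : k) == 0) = (n == 0)%N.
Proof. by move=> char0; apply/pcharf0P. Qed.

(** In characteristic zero 0, 1, 2, 3, 4 are distinct, too many roots for a nonzero polynomial of
    degree at most 4. *)
Lemma quartic_eq0 (k : fieldType) (c0 c1 c2 c3 c4 : k) : [pchar k] =i pred0 ->
  (forall s, c0 + c1 * s + c2 * s ^+ 2 + c3 * s ^+ 3 + c4 * s ^+ 4 = 0) ->
  [/\ c0 = 0, c1 = 0, c2 = 0, c3 = 0 & c4 = 0].
Proof.
move=> char0 H; pose p := Poly [:: c0; c1; c2; c3; c4].
have p0 : p = 0.
  apply/eqP; apply: contraTT (isT : true) => np.
  pose rs : seq k := [seq i%:R | i <- iota 0 5].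
  have urs : uniq rs.
    rewrite map_inj_uniq ?iota_uniq // => i j /eqP.
    wlog le_ij : i j / (i <= j)%N => [W|].
      by case: (leqP i j) => [/W //|/ltnW /W W' e]; apply/esym/W'; rewrite eq_sym.
    rewrite eq_sym -subr_eq0 -natrB // char0_natr_eq0 // subn_eq0 => le_ji.
    by apply/eqP; rewrite eqn_leq le_ij.
  have ars : all (root p) rs.
    apply/allP => s _; rewrite /root horner_Poly /=; apply/eqP.
    by rewrite -[RHS](H s); ring.
  have := max_poly_roots np ars urs; rewrite size_map size_iota ltnNge.
  by rewrite (leq_trans (size_Poly _)).
have E i : [:: c0; c1; c2; c3; c4]`_i = 0 by rewrite -coef_Poly -/p p0 coef0.
by split; [have := E 0%N | have := E 1%N | have := E 2%N | have := E 3%N | have := E 4%N].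
Qed.

Section StabilizerFinite.
Variables (k : fieldType) (l : k).
Hypothesis char0 : [pchar k] =i pred0.
Local Notation g := (quartic_family l).

Lemma meval_quartic_family v : g.@[v] =
  v o0 ^+ 3 * v o1 + v o1 ^+ 3 * v o2 + v o2 ^+ 3 * v o0 + v o3 ^+ 4
  + l * (v o0 * v o1 * v o2 * v o3).
Proof. by rewrite /quartic_family !(mevalD, mevalZ, mevalM, rmorphXn, mevalXU). Qed.

(* Obtained by replacing the coordinates of [u] by those of [v] one at a time;
   [difference_quotient v v] is the gradient of [g] at [v]. *)
Definition difference_quotient (u v : 'I_4 -> k) : 'I_4 -> k := vec4
  ((u o0 ^+ 2 + u o0 * v o0 + v o0 ^+ 2) * u o1 + u o2 ^+ 3 + l * (u o1 * u o2 * u o3))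
  (v o0 ^+ 3 + (u o1 ^+ 2 + u o1 * v o1 + v o1 ^+ 2) * u o2 + l * (v o0 * u o2 * u o3))
  (v o1 ^+ 3 + (u o2 ^+ 2 + u o2 * v o2 + v o2 ^+ 2) * v o0 + l * (v o0 * v o1 * u o3))
  ((u o3 + v o3) * (u o3 ^+ 2 + v o3 ^+ 2) + l * (v o0 * v o1 * v o2)).

Lemma difference_quotientE u v :
  g.@[u] - g.@[v] = \sum_i difference_quotient u v i * (u i - v i).
Proof. by rewrite !meval_quartic_family big_ord4 /difference_quotient /vec4 /=; ring. Qed.

(** The linear form [B |-> \sum_i q_i (B v)_i] on matrices, with [q = difference_quotient (A v) v],
    flattened to a row of length 16. At [A = 1] it is the differential at 1 of [B |-> g (B v)]. *)
Definition linearization (v : 'I_4 -> k) (A : 'M[k]_4) : 'rV[k]_(4 * 4) :=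
  mxvec ((\row_i difference_quotient (mxapp A v) v i)^T *m \row_j v j).

Lemma linearizationE v A (B : 'M[k]_4) :
  (linearization v A *m (mxvec B)^T) 0 0 =
  \sum_i difference_quotient (mxapp A v) v i * mxapp B v i.
Proof.
rewrite /linearization mxvec_dotmul -mulmxA mxE; apply: eq_bigr => i _.
by rewrite !mxE; congr (_ * _); apply: eq_bigr => j _; rewrite !mxE.
Qed.

(** Exactness of the difference quotient makes every form [linearization v A] kill [A - 1] when [A]
    fixes [g]. *)
Lemma linearization_subr1 v A :
  (linearization v A *m (mxvec (A - 1%:M))^T) 0 0 = g.@[mxapp A v] - g.@[v].
Proof.
rewrite linearizationE difference_quotientE; apply: eq_bigr => i _; congr (_ * _).
rewrite -[in RHS](mxapp1 v) mxapp1 -[v in X in _ = _ - X](mxapp1 v) /mxapp -sumrB.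
by apply: eq_bigr => j _; rewrite !mxE mulrBl.
Qed.

(** The hypothesis is a linear syzygy between the partial derivatives of [g]. On a line joining two
    coordinate vertices it becomes a polynomial in one variable, whose coefficients involve few
    entries of [B]. *)
Lemma gradient_no_syzygy (B : 'M[k]_4) :
  (forall v, \sum_i difference_quotient v v i * mxapp B v i = 0) -> B = 0.
Proof.
move=> H.
have Q x y z t := H (vec4 x y z t).
have {}Q x y z t :
  (3%:R * x ^+ 2 * y + z ^+ 3 + l * (y * z * t)) *
     (B o0 o0 * x + B o0 o1 * y + B o0 o2 * z + B o0 o3 * t) +
  (x ^+ 3 + 3%:R * y ^+ 2 * z + l * (x * z * t)) *
     (B o1 o0 * x + B o1 o1 * y + B o1 o2 * z + B o1 o3 * t) +
  (y ^+ 3 + 3%:R * z ^+ 2 * x + l * (x * y * t)) *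
     (B o2 o0 * x + B o2 o1 * y + B o2 o2 * z + B o2 o3 * t) +
  (4%:R * t ^+ 3 + l * (x * y * z)) *
     (B o3 o0 * x + B o3 o1 * y + B o3 o2 * z + B o3 o3 * t) = 0.
  rewrite -[RHS](Q x y z t) big_ord4 /mxapp !big_ord4 /difference_quotient /vec4 /=.
  by ring.
have [|b10 e01 _ b20 b21] := @quartic_eq0 k (B o1 o0) (3%:R * B o0 o0 + B o1 o1)
   (3%:R * B o0 o1) (B o2 o0) (B o2 o1) char0.
  by move=> s; rewrite -[RHS](Q 1 s 0 0); ring.
have [|_ e12 _ b01 b02] := @quartic_eq0 k (B o2 o1) (3%:R * B o1 o1 + B o2 o2)
   (3%:R * B o1 o2) (B o0 o1) (B o0 o2) char0.
  by move=> s; rewrite -[RHS](Q 0 1 s 0); ring.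
have [|_ e20 _ b12 _] := @quartic_eq0 k (B o0 o2) (3%:R * B o2 o2 + B o0 o0)
   (3%:R * B o2 o0) (B o1 o2) (B o1 o0) char0.
  by move=> s; rewrite -[RHS](Q s 0 1 0); ring.
have [|_ b13 _ e30 e33] := @quartic_eq0 k (B o1 o0) (B o1 o3) 0
   (4%:R * B o3 o0) (4%:R * B o3 o3) char0.
  by move=> s; rewrite -[RHS](Q 1 0 0 s); ring.
have [|_ b23 _ e31 _] := @quartic_eq0 k (B o2 o1) (B o2 o3) 0
   (4%:R * B o3 o1) (4%:R * B o3 o3) char0.
  by move=> s; rewrite -[RHS](Q 0 1 0 s); ring.
have [|_ b03 _ e32 _] := @quartic_eq0 k (B o0 o2) (B o0 o3) 0
   (4%:R * B o3 o2) (4%:R * B o3 o3) char0.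
  by move=> s; rewrite -[RHS](Q 0 0 1 s); ring.
have natr_cancel n (x : k) : n.+1%:R * x = 0 -> x = 0.
  by move=> /eqP; rewrite mulf_eq0 char0_natr_eq0 //= => /eqP.
(* The relations [3 b00 + b11 = 0], [3 b11 + b22 = 0] and [3 b22 + b00 = 0] give [28 b00 = 0];
   [natr_cancel] takes the predecessor of the integer to cancel. *)
have b00 : B o0 o0 = 0.
  apply: (natr_cancel 27); rewrite -e20.
  have -> : B o2 o2 = - (3%:R * B o1 o1) by apply/eqP; rewrite -addr_eq0 addrC e12.
  have -> : B o1 o1 = - (3%:R * B o0 o0) by apply/eqP; rewrite -addr_eq0 addrC e01.
  by ring.
have b11 : B o1 o1 = 0 by rewrite -e01 b00; ring.
have b22 : B o2 o2 = 0 by rewrite -e12 b11; ring.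
apply/matrixP => i j; rewrite [RHS]mxE; move: i j.
by elim/ord4P; elim/ord4P => //; apply: (natr_cancel 3).
Qed.

Lemma stabilizer_bound : exists r, forall (n : nat) (A : 'I_n -> 'M[k]_4),
  (forall i, A i \in unitmx) -> (forall i v, g.@[mxapp (A i) v] = g.@[v]) ->
  injective A -> (n <= r)%N.
Proof.
(* In the absence of linear syzygies the differentials at 1 span the dual of the space of matrices,
   and 16 vectors [s i] suffice. *)
have [b Hb|s us] := @functional_basis k ('I_4 -> k) (4 * 4) (fun v => linearization v 1%:M).
  have bE : b = (mxvec (vec_mx b^T))^T by rewrite vec_mxK trmxK.
  suff B0 : vec_mx b^T = 0 by rewrite bE B0 linear0 trmx0.
  apply: gradient_no_syzygy => v.
  have := congr1 (fun M : 'M_1 => M 0 0) (Hb v).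
  by rewrite bE linearizationE mxapp1 -bE [RHS]mxE.
pose M A := \matrix_i linearization (s i) A.
(* The rows of [M A] kill [A - 1], so [h A = \det (M A)] vanishes on the stabilizer outside 1, while
   [us] says that [h 1] is nonzero. *)
have isolated A : \det (M A) != 0 -> (forall v, g.@[mxapp A v] = g.@[v]) -> A = 1%:M.
  move=> dA gA; have uM : M A \in unitmx by rewrite unitmxE unitfE.
  have e0 : M A *m (mxvec (A - 1%:M))^T = 0.
    apply/row_matrixP => i; rewrite row_mul rowK row0.
    by apply/rowP => j; rewrite ord1 linearization_subr1 gA subrr mxE.
  have {e0} : (mxvec (A - 1%:M))^T = 0 by rewrite -(mulKmx uM (mxvec _)^T) e0 mulmx0.
  move=> /(congr1 trmx); rewrite trmxK trmx0 => /(congr1 vec_mx).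
  by rewrite mxvecK linear0 => /eqP; rewrite subr_eq0 => /eqP.
(* The kernel [h (P^-1 A)] is polynomial in the entries of [invmx P] and [A]. The inverse does no
   harm: a factor depending on [P] alone has finite rank, whatever function it is. *)
have [|r Hr] := @finite_rank_diagonal k _ _
    (fun P A : 'M[k]_4 => \det (M (invmx P *m A))).
  apply: finite_rank_det => i t; case/mxvec_indexP: t => a c.
  pose v := s i.
  have U e : finite_rank (fun P A : 'M[k]_4 => mxapp (invmx P *m A) v e).
    apply: (finite_rank_ext (L := fun P A => \sum_j invmx P e j * mxapp A v j)).
      by move=> P A; rewrite mxappM.
    apply: finite_rank_sum => j.
    by apply: finite_rankM; [apply: finite_rank_left | apply: finite_rank_right].
  have FC (x : k) : finite_rank (fun P A : 'M[k]_4 => x) by apply: finite_rank_left.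
  have FX (K : 'M[k]_4 -> 'M[k]_4 -> k) e : finite_rank K -> finite_rank (fun P A => K P A ^+ e).
    move=> FK; elim: e => [|e IH]; first exact: FC.
    by apply: finite_rank_ext (finite_rankM FK IH) => P A; rewrite exprS.
  apply: (finite_rank_ext (L := fun P A =>
      difference_quotient (mxapp (invmx P *m A) v) v a * v c)).
    by move=> P A; rewrite mxE mxvecE !mxE big_ord1 !mxE.
  apply: finite_rankM; last exact: FC.
  by elim/ord4P: a; rewrite /difference_quotient /vec4 /=;
    repeat first [exact: U | exact: FC | apply: FX | apply: finite_rankD | apply: finite_rankM].
(* Both arguments run over the same matrices: [A_i^-1 A_j] fixes [g], so the kernel is nonzero
   exactly when [A_i = A_j]. *)
exists r => n A uA gA injA; apply: (Hr n A A) => i j.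
have ginv v : g.@[mxapp (invmx (A i)) v] = g.@[v].
  by rewrite -[LHS](gA i) -mxappM mulmxV // mxapp1.
apply/eqP/idP => [d0|].
  apply: contraTneq us => ij; move: d0; rewrite ij mulVmx // unitmxE unitfE => ->.
  by rewrite eqxx.
apply: contraNeq => dn; apply/eqP/injA.
suff e : invmx (A i) *m A j = 1%:M by rewrite -[LHS]mulmx1 -e mulKVmx.
by apply: isolated => // v; rewrite mxappM ginv gA.
Qed.

End StabilizerFinite.

(** * Quartics in the monomials of [f^lambda] *)

Section QuarticMonomials.
Variable k : fieldType.
Implicit Types (v : 'I_4 -> k).

(** Writing monomials as products of four variables, repetitions allowed, lets one Leibniz formula
    evaluate all derivatives. *)
Definition quad (p q r s : 'I_4) : {mpoly k[4]} := 'X_p * 'X_q * 'X_r * 'X_s.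

Lemma meval_quad v p q r s : (quad p q r s).@[v] = v p * v q * v r * v s.
Proof. by rewrite /quad !mevalM !mevalXU. Qed.

Lemma meval_mderiv_quad v i p q r s : ((quad p q r s)^`M(i)).@[v] =
  (p == i)%:R * v q * v r * v s + (q == i)%:R * v p * v r * v s +
  (r == i)%:R * v p * v q * v s + (s == i)%:R * v p * v q * v r.
Proof.
rewrite /quad !mderivM !mderivXU !(mevalD, mevalM) !mevalC !mevalXU.
by ring.
Qed.

(* The quartics fixed by [diag (w, w^4, w^2, 1)]. *)
Definition weighted_quartic (a b c e q : k) : {mpoly k[4]} :=
  a *: quad o0 o0 o0 o1 + b *: quad o1 o1 o1 o2 + c *: quad o0 o2 o2 o2
  + e *: quad o3 o3 o3 o3 + q *: quad o0 o1 o2 o3.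

Lemma quartic_family_weighted l : quartic_family l = weighted_quartic 1 1 1 1 l.
Proof.
have -> : quartic_family l = 'X_o0 ^+ 3 * 'X_o1 + 'X_o1 ^+ 3 * 'X_o2 + 'X_o0 * 'X_o2 ^+ 3
    + 'X_o3 ^+ 4 + l *: quad o0 o1 o2 o3 by rewrite ['X_o0 * _]mulrC.
by rewrite /weighted_quartic /quad !scale1r !exprS !expr0 !mulr1 !mulrA. Qed.

Lemma weighted_quartic_singular a b c e q x y z t :
  3%:R * a * x ^+ 2 * y + c * z ^+ 3 + q * y * z * t = 0 ->
  a * x ^+ 3 + 3%:R * b * y ^+ 2 * z + q * x * z * t = 0 ->
  b * y ^+ 3 + 3%:R * c * z ^+ 2 * x + q * x * y * t = 0 ->
  4%:R * e * t ^+ 3 + q * x * y * z = 0 ->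
  a * x ^+ 3 * y + b * y ^+ 3 * z + c * z ^+ 3 * x + e * t ^+ 4 + q * x * y * z * t = 0 ->
  singular_at (weighted_quartic a b c e q) (vec4 x y z t).
Proof.
move=> e0 e1 e2 e3 ev; split.
  rewrite -[RHS]ev /weighted_quartic !mevalD !mevalZ !meval_quad /vec4 /=.
  by ring.
move=> i; rewrite /weighted_quartic !mderivD !mderivZ !mevalD !mevalZ !meval_mderiv_quad.
elim/ord4P: i; rewrite /vec4 /=.
- by rewrite -[RHS]e0; ring.
- by rewrite -[RHS]e1; ring.
- by rewrite -[RHS]e2; ring.
- by rewrite -[RHS]e3; ring.
Qed.

Lemma lin_subst_quad_diag (d : 'rV[k]_4) p q r s :
  lin_subst (quad p q r s) (diag_mx d) = (d 0 p * d 0 q * d 0 r * d 0 s) *: quad p q r s.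
Proof.
have XD i : lin_subst 'X_i (diag_mx d) = d 0 i *: 'X_i.
  rewrite lin_substX (bigD1 i) //= big1 ?addr0 ?mxE ?eqxx // => j ji.
  by rewrite mxE eq_sym (negbTE ji) scale0r.
rewrite /quad !lin_subst_prod !XD -!(scalerAl, scalerAr) !scalerA.
by congr (_ *: _); ring.
Qed.

Lemma lin_subst_weighted_quartic (d : 'rV[k]_4) a b c e q :
  lin_subst (weighted_quartic a b c e q) (diag_mx d) = weighted_quartic
    (a * (d 0 o0 ^+ 3 * d 0 o1)) (b * (d 0 o1 ^+ 3 * d 0 o2)) (c * (d 0 o2 ^+ 3 * d 0 o0))
    (e * d 0 o3 ^+ 4) (q * (d 0 o0 * d 0 o1 * d 0 o2 * d 0 o3)).
Proof.
rewrite /weighted_quartic !lin_substD !lin_substZ !lin_subst_quad_diag !scalerA.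
by congr (_ *: _ + _ *: _ + _ *: _ + _ *: _ + _ *: _); ring.
Qed.

End QuarticMonomials.

Arguments quad {k} p q r s.

(** * Roots of unity and matrix powers *)

Section Roots.
Variable k : closedFieldType.

Lemma closed_field_nth_root (n : nat) (a : k) : (0 < n)%N -> exists x, x ^+ n = a.
Proof.
move=> n_gt0; have [|x] := @closed_rootP k ('X^n - a%:P) _.
  by rewrite size_XnsubC // eqSS -lt0n.
by rewrite /root !hornerE subr_eq0 => /eqP; exists x.
Qed.

(** A root of [1 + X + ... + X^6] works: its product with [X - 1] is [X^7 - 1], and its value at 1
    is 7, which is not 0. *)
Lemma exists_seventh_root : [pchar k] =i pred0 -> exists2 w : k, w != 1 & w ^+ 7 = 1.
Proof.
move=> char0; pose p : {poly k} := \poly_(i < 7) 1.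
have [|w] := @closed_rootP k p _.
  by rewrite size_poly_eq ?oner_eq0.
rewrite /root horner_poly !big_ord_recr big_ord0 /= => /eqP rw.
have w7 : w ^+ 7 - 1 = 0 by rewrite -(mulr0 (w - 1)) -rw; ring.
exists w; last by apply/eqP; rewrite -subr_eq0 w7.
apply: contraNneq (_ : (7%:R : k) != 0); last by rewrite char0_natr_eq0.
by move=> w1; rewrite -rw w1; apply/eqP; ring.
Qed.

End Roots.

Lemma seventh_root_prim (k : fieldType) (w : k) : w != 1 -> w ^+ 7 = 1 -> 7.-primitive_root w.
Proof.
move=> w1 /(@prim_order_exists _ 7 w isT)[m wm /(prime_nt_dvdP (isT : prime 7)) m7].
have [m1|/m7 <- //] := eqVneq m 1%N.
by move: wm; rewrite m1 => /prim_expr_order; rewrite expr1 => e; rewrite e eqxx in w1.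
Qed.

Section MatrixPowers.
Variables (k : fieldType) (n : nat).

Lemma exprmx_conj (P A B : 'M[k]_n.+1) e :
  P \in unitmx -> P *m A = B *m P -> P *m A ^+ e = B ^+ e *m P.
Proof.
move=> uP PA; elim: e => [|e IH]; first by rewrite !expr0 mulmx1 mul1mx.
by rewrite !exprS mulmxA PA -mulmxA IH mulmxA.
Qed.

Lemma exprmx_diag (d : 'rV[k]_n.+1) e :
  diag_mx d ^+ e = diag_mx (map_mx (fun x => x ^+ e) d).
Proof.
elim: e => [|e IH].
  by apply/matrixP => i j; rewrite expr0 !mxE expr0.
rewrite exprS IH -mulmxE mulmx_diag; congr diag_mx; apply/rowP => i.
by rewrite !mxE exprS.
Qed.

Lemma lin_subst_exprmx (f : {mpoly k[n.+1]}) (A : 'M[k]_n.+1) c e :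
  lin_subst f A = c *: f -> lin_subst f (A ^+ e) = c ^+ e *: f.
Proof.
move=> fA; elim: e => [|e IH]; first by rewrite !expr0 lin_subst1 scale1r.
by rewrite exprS -lin_subst_mulmx fA lin_substZ IH scalerA -exprS.
Qed.

End MatrixPowers.

(** * Automorphisms of forms equivalent to [f^lambda] *)

Section FamilyToPaut.
Variables (k : closedFieldType) (f : {mpoly k[4]}) (l : k) (T : GL k 4) (c : k).
Hypotheses (char0 : [pchar k] =i pred0) (hf : f \is 4.-homog) (c0 : c != 0).
Hypothesis fT : lin_subst f T = c *: quartic_family l.
Local Notation g := (quartic_family l).

Lemma quartic_familyE (A : 'M[k]_4) : lin_subst g A = c^-1 *: lin_subst f (T *m A).
Proof. by rewrite -lin_subst_mulmx fT lin_substZ scalerA mulVf // scale1r. Qed.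

(** Conjugation by [T] turns an automorphism of [f] into a matrix multiplying [g] by a constant [e];
    scaling it by a fourth root of [e^-1] makes it fix [g]. *)
Lemma Paut_normalized_representative (a : PGL k 4) : Paut f a ->
  exists M : 'M[k]_4, [/\ M \in unitmx, forall v, g.@[mxapp M v] = g.@[v]
    & exists2 s, s != 0 & GLmx (repr a) = s *: (T *m M *m invmx T)].
Proof.
rewrite -{1}(reprK a) => /(Paut_pi _ hf)[e e0 fA]; set A := GLmx (repr a) in fA *.
have [s se] := @closed_field_nth_root k 4 e^-1 isT.
have uT := GLmx_unit T; have uA : A \in unitmx := GLmx_unit _.
have s0 : s != 0.
  by apply: contraNneq e0 => s0; move: se; rewrite s0 expr0n /= => /eqP; rewrite eq_sym invr_eq0.
exists (s *: (invmx T *m A *m T)); split.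
- by rewrite unitmxZ ?unitfE // !unitmx_mul unitmx_inv uT uA.
- move=> v; rewrite -meval_lin_subst quartic_familyE -scalemxAr (lin_subst_scalemx _ _ hf).
  rewrite !mulmxA mulmxV // mul1mx -lin_subst_mulmx fA lin_substZ fT !scalerA se.
  by rewrite (_ : _ * c = 1) ?scale1r //; field; rewrite e0 c0.
- exists s^-1; first by rewrite invr_eq0.
  rewrite -scalemxAr -scalemxAl scalerA mulVf // scale1r.
  by rewrite !mulmxA mulmxV // mul1mx mulmxK.
Qed.

(** A class is determined by its normalized matrix, so distinct classes give distinct matrices
    fixing [g], whose number is bounded. *)
Lemma Paut_finite : finite_set (Paut f).
Proof.
have [r Hr] := stabilizer_bound l char0.
apply: contrapT => /(infinite_set_fset r.+1)[B BP cB].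
have inP (a : B) : Paut f (val a) by apply: BP; apply: (valP a).
have /boolp.choice[M HM] (a : B) := Paut_normalized_representative (inP a).
suff : (#|{: B}| <= r)%N by rewrite -cardfE leqNgt cB.
apply: (Hr _ (fun i => M (enum_val i))).
- by move=> i; have [] := HM (enum_val i).
- by move=> i; have [] := HM (enum_val i).
- move=> i j Mij; apply: enum_val_inj; apply: val_inj.
  have [_ _ [s s0 es]] := HM (enum_val i); have [_ _ [t t0 et]] := HM (enum_val j).
  rewrite -[LHS]reprK -[RHS]reprK; apply/pi_PGL_eq.
  exists (s / t); first by rewrite mulf_neq0 ?invr_eq0.
  by rewrite es et Mij scalerA divfK.
Qed.

Lemma order7_automorphism : exists A : GL k 4,
  [/\ proportional (lin_subst f A) f, ~ (exists e, GLmx A = e%:M)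
    & exists2 e, e != 0 & GLmx A ^+ 7 = e%:M].
Proof.
have [w w1 w7] := exists_seventh_root char0.
pose d : 'rV[k]_4 := \row_i vec4 w (w ^+ 4) (w ^+ 2) 1 i.
have uT := GLmx_unit T.
have D7 : diag_mx d ^+ 7 = 1%:M.
  rewrite exprmx_diag -diag_const_mx; congr diag_mx; apply/rowP => i; rewrite !mxE.
  by elim/ord4P: i; rewrite /vec4 /= ?expr1n // -exprM mulnC exprM w7 expr1n.
have uA : T *m diag_mx d *m invmx T \in unitmx.
  rewrite !unitmx_mul uT unitmx_inv uT andbT /=.
  by rewrite -(unitrX_pos _ (isT : (0 < 7)%N)) D7 unitr1.
have TV : invmx T *m (T *m diag_mx d *m invmx T) = diag_mx d *m invmx T.
  by rewrite !mulmxA mulVmx // mul1mx.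
exists (MkGL uA); split.
- exists 1; rewrite ?oner_eq0 // scale1r /=.
  (* The exponents of [w] on the five monomials are 7, 14, 7, 0 and 7. *)
  have gD : lin_subst g (diag_mx d) = g.
    rewrite quartic_family_weighted lin_subst_weighted_quartic !mxE /vec4 /=.
    by congr weighted_quartic; ring: w7.
  have fE : f = c *: lin_subst g (invmx T).
    by rewrite quartic_familyE mulmxV // lin_subst1 scalerA mulfV // scale1r.
  by rewrite {1}fE lin_substZ lin_subst_mulmx TV -lin_subst_mulmx gD -fE.
- move=> [e /= eA]; case/eqP: w1.
  have {eA} De : diag_mx d = e%:M.
    rewrite -[LHS](mulKmx uT) -[X in invmx T *m X](mulmxKV uT) eA.
    by rewrite mul_scalar_mx -scalemxAr mulVmx // scalemx1.
  have := congr1 (fun M : 'M[k]_4 => M o0 o0) De.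
  have := congr1 (fun M : 'M[k]_4 => M o3 o3) De.
  by rewrite !mxE /= !mulr1n /vec4 /= => <-.
- exists 1; rewrite ?oner_eq0 //=.
  have uV : invmx T \in unitmx by rewrite unitmx_inv.
  have := exprmx_conj 7 uV TV; rewrite D7 mul1mx => e.
  by rewrite -[LHS](mulKVmx uT) e mulmxV.
Qed.

End FamilyToPaut.

(** * Automorphisms of order 7 *)

Section Order7Normalization.
Variables (k : closedFieldType) (f : {mpoly k[4]}).
Hypotheses (char0 : [pchar k] =i pred0) (hf : f \is 4.-homog) (f0 : f != 0).

(** A seventh root rescales [A] to satisfy [A^7 = 1]. Then [f] is multiplied by some [b] with
    [b^7 = 1]; as 4 is invertible modulo 7, scaling by a suitable power of [b] removes this factor
    and keeps the seventh power equal to 1. *)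
Lemma order7_rescale (A : 'M[k]_4) :
  proportional (lin_subst f A) f -> ~ (exists e, A = e%:M) ->
  (exists2 e, e != 0 & A ^+ 7 = e%:M) ->
  exists B : 'M[k]_4, [/\ lin_subst f B = f, B != 1%:M & B ^+ 7 = 1%:M].
Proof.
move=> [c c0 fA] nA [e e0 A7].
have [s s7] := @closed_field_nth_root k 7 e^-1 isT.
have sA7 : (s *: A) ^+ 7 = 1%:M.
  by rewrite exprZn s7 A7 scale_scalar_mx mulVf.
pose b := s ^+ 4 * c.
have fsA : lin_subst f (s *: A) = b *: f.
  by rewrite (lin_subst_scalemx _ _ hf) fA scalerA.
have b7 : b ^+ 7 = 1.
  have /eqP := lin_subst_exprmx 7 fsA; rewrite sA7 lin_subst1 -subr_eq0.
  by rewrite -{1}[f]scale1r -scalerBl scaler_eq0 (negbTE f0) orbF subr_eq0 => /eqP.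
(* [b * (b ^ 5) ^ 4 = b ^ 21 = 1] *)
exists (b ^+ 5 *: (s *: A)); split.
- rewrite (lin_subst_scalemx _ _ hf) fsA scalerA.
  rewrite (_ : _ * _ = (b ^+ 7) ^+ 3); last by ring.
  by rewrite b7 expr1n scale1r.
- apply/eqP; rewrite scalerA => e1; apply: nA; exists (b ^+ 5 * s)^-1.
  have bs : b ^+ 5 * s != 0.
    apply/eqP => bs0; move: e1; rewrite bs0 scale0r => /matrixP/(_ o0 o0)/eqP.
    by rewrite !mxE eq_sym oner_eq0.
  by rewrite -scalemx1 -e1 scalerA mulVf ?scale1r.
- by rewrite exprZn sA7 -exprM mulnC exprM b7 expr1n scale1r.
Qed.

(** The minimal polynomial divides [X^7 - 1], which splits with distinct roots [w^i]. *)
Lemma order7_diagonalizable (A : 'M[k]_4) : A ^+ 7 = 1%:M ->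
  exists2 P, P \in unitmx & exists d : 'rV[k]_4, P *m A = diag_mx d *m P.
Proof.
move=> A7; have [w w1 w7] := exists_seventh_root char0.
have wp := seventh_root_prim w1 w7.
have [|P uP /diagonalizable_forPex[d /(simmxP uP) PA]] := (diagonalizableP A).2.
  exists [seq w ^+ i | i <- index_iota 0 7].
    rewrite map_inj_in_uniq ?iota_uniq // => i j; rewrite !mem_index_iota => iI jI.
    by move/eqP; rewrite (eq_prim_root_expr wp) !modn_small // => /eqP.
  rewrite big_map (factor_Xn_sub_1 wp); apply: mxminpoly_min.
  by rewrite rmorphB rmorphXn /= horner_mx_X rmorph1 A7 subrr.
by exists P => //; exists d.
Qed.

End Order7Normalization.

(** * Homogeneous forms at the coordinate vertices *)

Section HomogeneousForms.
Variables (k : fieldType) (n : nat).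
Implicit Types (f p : {mpoly k[n]}) (m : 'X_{1..n}) (v d : 'I_n -> k).

Lemma dhomog_big_prod (I : Type) (r : seq I) (F : I -> {mpoly k[n]}) (e : I -> nat) :
  (forall i, F i \is (e i).-homog) ->
  \prod_(i <- r) F i \is (\sum_(i <- r) e i).-homog.
Proof.
move=> FH; elim: r => [|i r IH]; first by rewrite !big_nil dhomog1.
by rewrite !big_cons; apply: dhomogM.
Qed.

Lemma dhomog_lin_subst f e (A : 'M[k]_n) :
  f \is e.-homog -> lin_subst f A \is e.-homog.
Proof.
move=> /dhomogP hf; rewrite /lin_subst comp_mpolyEX big_seq; apply: rpred_sum => m fm.
apply: dhomogZ; have /= <- := hf m fm; rewrite comp_mpolyX mdegE; apply: dhomog_big_prod => i.
rewrite -[X in X.-homog]mul1n; apply: dhomogMn; rewrite tnth_mktuple.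
by apply: rpred_sum => j _; apply: dhomogZ; rewrite dhomogX /= mdeg1.
Qed.

Lemma dhomog_mderiv f e i : f \is e.+1.-homog -> f^`M(i) \is e.-homog.
Proof.
move=> /dhomogP hf; apply/dhomogP => m; rewrite mcoeff_msupp mcoeff_deriv => nz.
have /hf /= : (m + U_(i))%MM \in msupp f.
  by rewrite mcoeff_msupp; apply: contraNneq nz => ->; rewrite mul0rn.
by rewrite mdegD mdeg1 addn1 => -[].
Qed.

(** Any monomial of degree [e] other than [X_i^e] contains a variable that vanishes at the
    vertex. *)
Lemma meval_dhomog_delta p e i : p \is e.-homog ->
  p.@[fun j => (j == i)%:R] = p@_(U_(i) *+ e).
Proof.
move=> /dhomogP hp; rewrite mevalE.
have E m : m \in msupp p ->
    \prod_(j < n) ((j == i)%:R : k) ^+ m j = (m == U_(i) *+ e)%MM%:R.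
  move=> /hp /= me; case: eqP => [->|/eqP mi].
    rewrite (bigD1 i) //= eqxx expr1n mul1r big1 // => j ji.
    by rewrite mulmnE mnm1E [i == j]eq_sym (negbTE ji) mul0n expr0.
  have [j ji mj] : exists2 j, j != i & m j != 0%N.
    apply: contrapT => /forall2NP H; case/eqP: mi.
    have m0 j : j != i -> m j = 0%N by move=> ji; case: (H j) => // /negP; rewrite negbK => /eqP.
    apply/mnmP => j; rewrite mulmnE mnm1E; case: (eqVneq i j) => [<-|ij].
      rewrite mul1n -me mdegE (bigD1 i) //= big1 ?addn0 // => l /m0 //.
    by rewrite m0 // eq_sym.
  by rewrite (bigD1 j) //= (negbTE ji) expr0n (negbTE mj) mul0r.
rewrite big_seq; under eq_bigr => m mp do rewrite E //.
rewrite -big_seq; have [ip|ip] := boolP ((U_(i) *+ e)%MM \in msupp p).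
  rewrite (bigD1_seq _ ip) //= eqxx mulr1 big1 ?addr0 // => m /negbTE ->.
  by rewrite mulr0.
rewrite (memN_msupp_eq0 ip) big1_seq // => m /andP[_ mp].
by case: eqP => [e'|_]; [rewrite e' (negbTE ip) in mp | rewrite mulr0].
Qed.

(** At the vertex the value of [f] is its coefficient at [X_i^(e+1)], and the derivative in [X_j] is
    an integer multiple of the coefficient at [X_i^e X_j]. If all these coefficients vanished, the
    vertex would be singular. *)
Lemma nonsingular_vertex f e i : nonsingular f -> f \is e.+1.-homog ->
  exists j, f@_(U_(i) *+ e + U_(j)) != 0.
Proof.
move=> [_ nf] hf; apply: contrapT => /forallNP H.
have {}H j : f@_(U_(i) *+ e + U_(j)) = 0 by apply/eqP/negPn/negP.
apply: (nf (fun j => (j == i)%:R)); first by exists i; rewrite eqxx oner_eq0.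
split=> [|j]; first by rewrite (meval_dhomog_delta _ hf) mulmSr H.
by rewrite (meval_dhomog_delta _ (dhomog_mderiv _ hf)) mcoeff_deriv H mul0rn.
Qed.

End HomogeneousForms.

(** * Eigenvalues of an automorphism of order 7 *)

Section DiagonalWeights.
Variable k : fieldType.

(* [d -> d^4] permutes the eigenvalues; its nontrivial orbits on the seventh
   roots of unity are [{w, w^4, w^2}]. *)
Lemma weights_classification (d : 'I_4 -> k) :
  (forall i, d i ^+ 7 = 1) -> (exists i, d i != 1) ->
  (forall i, exists j, d j = d i ^+ 4) ->
  exists (s : 'S_4) (w : k), w != 1 /\
    [/\ d (s o0) = w, d (s o1) = w ^+ 4, d (s o2) = w ^+ 2
      & d (s o3) = 1 \/ d (s o3) = w].
Proof.
move=> d7 [i0 n0] d4.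
have [i1 e1] := d4 i0; have [i2 e2] := d4 i1.
set w := d i0 in n0 e1 *; have w7 : w ^+ 7 = 1 := d7 i0.
(* The fourth power of [w^4] is [w^16 = w^2]. *)
have {}e2 : d i2 = w ^+ 2.
  by rewrite e2 e1 -[RHS]mulr1 -(expr1n _ 2) -w7; ring.
have wp := seventh_root_prim n0 w7.
have wE a b : (w ^+ a == w ^+ b) = (a == b %[mod 7])%N by apply: eq_prim_root_expr.
have n01 : i0 != i1.
  by apply/eqP => e; have := wE 1%N 4%N; rewrite -e1 -e expr1 eqxx.
have n02 : i0 != i2.
  by apply/eqP => e; have := wE 1%N 2%N; rewrite -e2 -e expr1 eqxx.
have n12 : i1 != i2.
  by apply/eqP => e; have := wE 4%N 2%N; rewrite -e1 -e2 e eqxx.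
have [i3] : exists i, i \notin [:: i0; i1; i2].
  apply: contrapT => /forallNP H; have : (#|'I_4| <= #|[:: i0; i1; i2]|)%N.
    by apply: subset_leq_card; apply/fintype.subsetP => i _; apply/negPn/negP.
  by move=> /leq_trans/(_ (card_size _)); rewrite card_ord.
rewrite !inE !negb_or => /and3P[n30 n31 n32].
have perm_of (a b c e : 'I_4) : uniq [:: a; b; c; e] -> exists s : 'S_4,
    [/\ s o0 = a, s o1 = b, s o2 = c & s o3 = e].
  move=> u; have inj : injective (fun i : 'I_4 => nth a [:: a; b; c; e] i).
    move=> i j e'; apply: val_inj; apply/eqP; rewrite -(nth_uniq a _ _ u) ?ltn_ord //.
    exact/eqP.
  by exists (perm inj); rewrite !permE.
have covers j : [|| j == i0, j == i1, j == i2 | j == i3].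
  have u : uniq [:: i0; i1; i2; i3].
    by rewrite /= !inE !negb_or n01 n02 n12 ![_ == i3]eq_sym n30 n31 n32.
  have [s [s0 s1 s2 s3]] := perm_of _ _ _ _ u.
  rewrite -[j](permKV s); move: ((s^-1)%g j); elim/ord4P;
    rewrite ?(s0, s1, s2, s3) eqxx ?orbT //.
set b := d i3; have b7 : b ^+ 7 = 1 := d7 i3.
have b8 : (b ^+ 4) ^+ 2 = b by rewrite -[RHS]mul1r -b7; ring.
have [j ej] := d4 i3; rewrite -/b in ej.
have [n10 n20 n21] : [/\ i1 != i0, i2 != i0 & i2 != i1] by split; rewrite eq_sym.
have [n03 n13 n23] : [/\ i0 != i3, i1 != i3 & i2 != i3] by split; rewrite eq_sym.
have uE := (n01, n02, n12, n10, n20, n21, n03, n13, n23).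
have w41 : w ^+ 4 != 1 by have := wE 4%N 0%N; rewrite expr0 => ->.
have w21 : w ^+ 2 != 1 by have := wE 2%N 0%N; rewrite expr0 => ->.
have w8 : w ^+ 8 = w by rewrite -[RHS]mul1r -w7; ring.
(* If [b^4] lies in the orbit of [w], so does [b = (b^4)^2]; the orbit is then rotated to start at
   [b]. *)
have [/eqP jE|/eqP jE|/eqP jE|/eqP jE] := or4P (covers j); rewrite {}jE in ej.
- have [|s [s0 s1 s2 s3]] := perm_of i2 i0 i1 i3; first by rewrite /= !inE !negb_or !uE.
  exists s, (w ^+ 2); rewrite s0 s1 s2 s3 e1 e2 -/w -/b; split=> //; split=> //.
  + by rewrite -exprM w8.
  + by rewrite -exprM.
  + by right; rewrite -b8 -ej.
- have [|s [s0 s1 s2 s3]] := perm_of i0 i1 i2 i3; first by rewrite /= !inE !negb_or !uE.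
  exists s, w; rewrite s0 s1 s2 s3 e1 e2 -/w -/b; split=> //; split=> //.
  by right; rewrite -b8 -ej e1 -exprM w8.
- have [|s [s0 s1 s2 s3]] := perm_of i1 i2 i0 i3; first by rewrite /= !inE !negb_or !uE.
  exists s, (w ^+ 4); rewrite s0 s1 s2 s3 e1 e2 -/w -/b; split=> //; split=> //.
  + by rewrite -exprM -(mulr1 (w ^+ 2)) -(expr1n _ 2) -w7; ring.
  + by rewrite -exprM w8.
  + by right; rewrite -b8 -ej e2 -exprM.
(* Here [b^4 = b], hence [b = b^7 = 1]. *)
have [|s [s0 s1 s2 s3]] := perm_of i0 i1 i2 i3; first by rewrite /= !inE !negb_or !uE.
exists s, w; rewrite s0 s1 s2 s3 e1 e2 -/w -/b; split=> //; split=> //; left.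
have b3 : b = b * b ^+ 3 by rewrite -exprS -ej.
by rewrite -b7 {1}b3 {1}b3; ring.
Qed.

End DiagonalWeights.

(** * Supports of invariant quartic forms *)

Lemma lin_subst_diag_fixed (k : fieldType) (n : nat) (f : {mpoly k[n]}) (d : 'rV[k]_n) m :
  lin_subst f (diag_mx d) = f -> f@_m != 0 -> \prod_i d 0 i ^+ m i = 1.
Proof.
move=> fd fm; have /eqP := mcoeff_lin_subst_diag f d m.
rewrite fd -subr_eq0 -{1}[f@_m]mul1r -mulrBl mulf_eq0 (negbTE fm) orbF subr_eq0.
by move=> /eqP.
Qed.

Definition monomial4 (t : nat * nat * nat * nat) : 'X_{1..4} :=
  let: (a, b, c, e) := t in [multinom nth 0%N [:: a; b; c; e] i | i < 4].

Section QuaternaryForms.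
Variable k : fieldType.
Implicit Types (f : {mpoly k[4]}) (m : 'X_{1..4}).

Lemma monomial4K m : monomial4 (m o0, m o1, m o2, m o3) = m.
Proof. by apply/mnmP => i; rewrite /monomial4 mnmE; elim/ord4P: i. Qed.

Lemma monomial4_inj : injective monomial4.
Proof.
move=> [[[a b] c] e] [[[a' b'] c'] e'] /mnmP H.
have := (H o0, H o1, H o2, H o3); rewrite !mnmE /=.
by move=> [[[-> ->] ->] ->].
Qed.

Lemma mpolyX_monomial4 a b c e : 'X_[monomial4 (a, b, c, e)] =
  'X_o0 ^+ a * 'X_o1 ^+ b * 'X_o2 ^+ c * 'X_o3 ^+ e :> {mpoly k[4]}.
Proof. by rewrite mpolyXE_id big_ord4 !mnmE. Qed.

Lemma mpoly_supported f (s : seq (nat * nat * nat * nat)) : uniq s ->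
  (forall m, f@_m != 0 -> (m o0, m o1, m o2, m o3) \in s) ->
  f = \sum_(t <- s) f@_(monomial4 t) *: 'X_[monomial4 t].
Proof.
move=> us H; apply/mpolyP => m; rewrite raddf_sum /=.
under eq_bigr => t _ do rewrite mcoeffZ mcoeffX.
have [fm|fm] := eqVneq f@_m 0.
  rewrite fm big1 // => t _; case: eqP => [->|_]; first by rewrite fm mul0r.
  by rewrite mulr0.
rewrite (bigD1_seq _ (H _ fm) us) monomial4K eqxx mulr1 big1 => [|t nt]; first by rewrite /= addr0.
case: eqP => [e|_]; last by rewrite mulr0.
by case/eqP: nt; apply: monomial4_inj; rewrite monomial4K e.
Qed.

(** This finds the support of an invariant form by evaluating a boolean over all exponents of degree
    4. The last exponent is a truncated difference, guarded by [a + b + c <= 4]. *)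
Lemma weight_check (P : nat * nat * nat * nat -> bool) (Q : seq (nat * nat * nat * nat)) :
  all (fun a => all (fun b => all (fun c => let t := (a, b, c, 4 - a - b - c)%N in
    (a + b + c <= 4)%N && P t ==> (t \in Q)) (iota 0 5)) (iota 0 5)) (iota 0 5) ->
  forall m, mdeg m = 4 -> P (m o0, m o1, m o2, m o3) -> (m o0, m o1, m o2, m o3) \in Q.
Proof.
move=> chk m; rewrite mdegE big_ord4 /= => me.
have -> : m o3 = (4 - m o0 - m o1 - m o2)%N by lia.
have /allP/(_ (m o0)) := chk; rewrite mem_iota => /(_ ltac:(lia)).
move=> /allP/(_ (m o1)); rewrite mem_iota => /(_ ltac:(lia)).
move=> /allP/(_ (m o2)); rewrite mem_iota => /(_ ltac:(lia))/implyP W Pt.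
by apply: W; rewrite Pt andbT; lia.
Qed.

End QuaternaryForms.

(** * Nonsingular invariant quartics *)

Section InvariantQuartics.
Variables (k : closedFieldType) (f : {mpoly k[4]}) (w : k) (d : 'rV[k]_4).
Hypotheses (char0 : [pchar k] =i pred0) (hf : f \is 4.-homog) (nf : nonsingular f).
Hypotheses (w1 : w != 1) (w7 : w ^+ 7 = 1) (fd : lin_subst f (diag_mx d) = f).
Hypotheses (d0 : d 0 o0 = w) (d1 : d 0 o1 = w ^+ 4) (d2 : d 0 o2 = w ^+ 2).

Lemma nonsingular_no_zero v : singular_at f v -> v = fun=> 0.
Proof.
move=> fv; apply: funext => i; apply/eqP/negPn/negP => vi.
by case: nf => _ /(_ v); apply=> //; exists i.
Qed.

(** With equal weights on [x] and [t], the form is [y C(x, t)] plus terms of degree at least 3 in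
    [y, z]. On the line [y = z = 0] it vanishes with all its derivatives except the one in [y],
    which is the binary cubic [C]; a zero of [C] is a singular point. *)
Lemma last_weight_neq : d 0 o3 <> w.
Proof.
move=> d3; have wp := seventh_root_prim w1 w7.
(* The exponents [(i, j, l, m)] of degree 4 with [i + 4 j + 2 l + m] divisible by 7. *)
pose s := [:: (3, 1, 0, 0); (2, 1, 0, 1); (1, 1, 0, 2); (0, 1, 0, 3);
              (0, 3, 1, 0); (1, 0, 3, 0); (0, 0, 3, 1)]%N.
have fE : f = \sum_(t <- s) f@_(monomial4 t) *: 'X_[monomial4 t].
  apply: mpoly_supported => // m fm.
  have := lin_subst_diag_fixed fd fm; rewrite big_ord4 /= d0 d1 d2 d3 -!exprM -!exprD.
  move=> /eqP; rewrite -(prim_order_dvd wp) => dv.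
  apply: (@weight_check (fun t => 7 %| t.1.1.1 + 4 * t.1.1.2 + 2 * t.1.2 + t.2)%N) => //.
  by move: hf => /dhomogP/(_ m); apply; rewrite mcoeff_msupp.
have {fE} [a3 [a2 [a1 [a0 [b [c [e fE]]]]]]] : exists a3 a2 a1 a0 b c e, f =
    a3 *: quad o0 o0 o0 o1 + a2 *: quad o0 o0 o1 o3 + a1 *: quad o0 o1 o3 o3
    + a0 *: quad o1 o3 o3 o3 + b *: quad o1 o1 o1 o2 + c *: quad o0 o2 o2 o2
    + e *: quad o2 o2 o2 o3.
  move: fE; rewrite !big_cons big_nil addr0 !mpolyX_monomial4 !addrA.
  rewrite !exprS !expr0 !(mulr1, mul1r) !mulrA -!/(quad _ _ _ _) => fE.
  by do 7! eexists; exact: fE.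
(* A nontrivial zero of the cubic: [(1, 0)] if [a3 = 0], otherwise a root of the polynomial obtained
   at [t = 1]. *)
have [x [t [xt Cxt]]] : exists x t, (x != 0) || (t != 0) /\
    a3 * x ^+ 3 + a2 * x ^+ 2 * t + a1 * x * t ^+ 2 + a0 * t ^+ 3 = 0.
  have [a30|a30] := eqVneq a3 0.
    by exists 1, 0; rewrite oner_eq0; split=> //; rewrite a30; ring.
  pose p := Poly [:: a0; a1; a2; a3].
  have [|x] := @closed_rootP k p _.
    by rewrite (@PolyK _ 0).
  rewrite /root horner_Poly /= => /eqP px; exists x, 1.
  by rewrite oner_eq0 orbT; split=> //; rewrite -[RHS]px; ring.
have sing : singular_at f (vec4 x 0 0 t).
  rewrite fE; split=> [|i].
    by rewrite !mevalD !mevalZ !meval_quad /vec4 /=; ring.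
  rewrite !mderivD !mderivZ !mevalD !mevalZ !meval_mderiv_quad.
  elim/ord4P: i; rewrite /vec4 /=.
  - by ring.
  - by rewrite -[RHS]Cxt; ring.
  - by ring.
  - by ring.
have /(congr1 (fun v => (v o0, v o3))) := nonsingular_no_zero sing.
by rewrite /vec4 /= => -[x0 t0]; rewrite x0 t0 eqxx in xt.
Qed.

(** Only monomials of weight divisible by 7 survive. At each coordinate vertex exactly one of
    [a, b, c, e] contributes to the value and gradient, so its vanishing would make the vertex
    singular. *)
Lemma fixed_weighted_quartic : d 0 o3 = 1 ->
  exists a b c e q, f = weighted_quartic a b c e q /\
    [/\ a != 0, b != 0, c != 0 & e != 0].
Proof.
move=> d3; have wp := seventh_root_prim w1 w7.
pose s := [:: (3, 1, 0, 0); (0, 3, 1, 0); (1, 0, 3, 0); (0, 0, 0, 4); (1, 1, 1, 1)]%N.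
have fE : f = \sum_(t <- s) f@_(monomial4 t) *: 'X_[monomial4 t].
  apply: mpoly_supported => // m fm.
  have := lin_subst_diag_fixed fd fm; rewrite big_ord4 /= d0 d1 d2 d3 expr1n mulr1 -!exprM -!exprD.
  move=> /eqP; rewrite -(prim_order_dvd wp) => dv.
  apply: (@weight_check (fun t => 7 %| t.1.1.1 + 4 * t.1.1.2 + 2 * t.1.2)%N) => //.
  by move: hf => /dhomogP/(_ m); apply; rewrite mcoeff_msupp.
have {}fE : exists a b c e q, f = weighted_quartic a b c e q.
  move: fE; rewrite !big_cons big_nil addr0 !mpolyX_monomial4 !addrA.
  rewrite !exprS !expr0 !(mulr1, mul1r) !mulrA -!/(quad _ _ _ _) => fE.
  by do 5! eexists; exact: fE.
have [a [b [c [e [q fq]]]]] := fE.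
exists a, b, c, e, q; split=> //.
have contra x y z t : singular_at f (vec4 x y z t) -> [/\ x = 0, y = 0, z = 0 & t = 0].
  move=> /nonsingular_no_zero /(congr1 (fun v => (v o0, v o1, v o2, v o3))).
  by rewrite /vec4 /= => -[-> -> -> ->].
have one0 : 1 <> 0 :> k by apply/eqP; rewrite oner_eq0.
split; apply/eqP => z0; rewrite fq z0 in contra.
- by have [|/one0 []] := contra 1 0 0 0; apply: weighted_quartic_singular; ring.
- by have [|_ /one0 []] := contra 0 1 0 0; apply: weighted_quartic_singular; ring.
- by have [|_ _ /one0 []] := contra 0 0 1 0; apply: weighted_quartic_singular; ring.
- by have [|_ _ _ /one0 []] := contra 0 0 0 1; apply: weighted_quartic_singular; ring.
Qed.

End InvariantQuartics.

(** * Normalization to [f^lambda] *)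

(** A diagonal substitution has four free scalars, enough to bring the first four coefficients to 1;
    what becomes of [q] is the parameter [l]. *)
Lemma weighted_quartic_rescale (k : closedFieldType) (a b c e q : k) :
  a != 0 -> b != 0 -> c != 0 -> e != 0 ->
  exists2 D : 'M[k]_4, D \in unitmx &
    exists l, lin_subst (weighted_quartic a b c e q) D = quartic_family l.
Proof.
move=> a0 b0 c0 e0.
have [x xE] := @closed_field_nth_root k 28 (b ^+ 3 / (c * a ^+ 9)) isT.
have [t tE] := @closed_field_nth_root k 4 e^-1 isT.
have neq0 (y z : k) n : z != 0 -> y ^+ n.+1 = z -> y != 0.
  by move=> z0 yz; apply: contraNneq z0 => y0; rewrite -yz y0 expr0n.
have x0 : x != 0 by apply: neq0 xE; rewrite mulf_neq0 ?invr_eq0 ?mulf_neq0 ?expf_neq0.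
have t0 : t != 0 by apply: neq0 tE; rewrite invr_eq0.
(* [y] and [z] normalise [x^3 y] and [y^3 z]; then [c z^3 x = c a^9 x^28 / b^3]. *)
pose y := (a * x ^+ 3)^-1; pose z := (b * y ^+ 3)^-1.
have y0 : y != 0 by rewrite invr_eq0 mulf_neq0 ?expf_neq0.
have z0 : z != 0 by rewrite invr_eq0 mulf_neq0 ?expf_neq0.
pose d : 'rV[k]_4 := \row_i vec4 x y z t i.
exists (diag_mx d).
  rewrite unitmxE det_diag unitfE big_ord4 !mxE /vec4 /= !mulf_neq0 //.
exists (q * (x * y * z * t)).
rewrite quartic_family_weighted lin_subst_weighted_quartic !mxE /vec4 /=.
congr weighted_quartic.
- by rewrite /y; field; rewrite a0 x0.
- by rewrite /z; field; rewrite b0 y0.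
- have -> : c * (z ^+ 3 * x) = c * a ^+ 9 / b ^+ 3 * x ^+ 28.
    by rewrite /z /y; field; rewrite a0 b0 x0.
  by rewrite xE; field; rewrite a0 b0 c0.
- by rewrite tE mulfV.
Qed.

(** At [x = y = z = 1] the derivatives in [x, y, z] vanish when [l t = -4], and the one in [t] is
    then zero exactly when [l^4 = 4^4]; this locates the singular point [(1, 1, 1, -4/l)]. *)
Lemma nonsingular_quartic_family (k : fieldType) (l : k) : [pchar k] =i pred0 ->
  nonsingular (quartic_family l) -> l ^+ 4 != 4%:R ^+ 4.
Proof.
move=> char0 [_ nf]; apply/eqP => l4.
have n4 : (4%:R : k) != 0 by rewrite char0_natr_eq0.
have l0 : l != 0.
  by apply: contraNneq (expf_neq0 4 n4) => l0; rewrite -l4 l0 expr0n.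
apply: (nf (vec4 1 1 1 (- 4%:R / l))); first by exists o0; rewrite oner_eq0.
have tE : 4%:R * (- 4%:R / l) ^+ 3 + l = 0.
  have -> : 4%:R * (- 4%:R / l) ^+ 3 + l = (l ^+ 4 - 4%:R ^+ 4) / l ^+ 3 by field.
  by rewrite l4 subrr mul0r.
have tE' : l * (- 4%:R / l) = - 4%:R by field.
rewrite quartic_family_weighted; apply: weighted_quartic_singular.
- by rewrite !mulr1 tE'; ring.
- by rewrite !mulr1 tE'; ring.
- by rewrite !mulr1 tE'; ring.
- by rewrite !mulr1 tE.
- have -> : (- 4%:R / l) ^+ 4 = 1.
    have -> : (- 4%:R / l) ^+ 4 = 4%:R ^+ 4 / l ^+ 4 by field.
    by rewrite l4 divff ?expf_neq0.
  by rewrite !mulr1 tE'; ring.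
Qed.

Theorem theorem4p2 (k : closedFieldType) (char0 : [pchar k] =i pred0)
    (f : {mpoly k[4]}) (f_quartic : f \is 4.-homog) (f_nonsing : nonsingular f) :
  card_divisible_by 7 (Paut f) <->
  exists2 lambda : k, lambda ^+ 4 != 4%:R ^+ 4 &
    proj_equiv f (quartic_family lambda).
Proof.
split=> [[m Pm m7]|[l _ [T [c c0 fT]]]]; last first.
  have /finite_setP[m Pm] := Paut_finite char0 f_quartic c0 fT.
  exists m => //; apply/(Paut_card_prime f_quartic (isT : prime 7) Pm).
  exact: order7_automorphism c0 fT.
have [A [fA nA A7]] := (Paut_card_prime f_quartic (isT : prime 7) Pm).1 m7.
have [f0 _] := f_nonsing.
have [B [fB B1 B7]] := order7_rescale f_quartic f0 fA nA A7.
have [P uP [d PB]] := order7_diagonalizable char0 B7.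
have uV : invmx P \in unitmx by rewrite unitmx_inv.
have BE : B = invmx P *m diag_mx d *m P by rewrite -mulmxA -PB mulKmx.
have d7 i : d 0 i ^+ 7 = 1.
  have := exprmx_conj 7 uP PB; rewrite B7 mulmx1 exprmx_diag => /(congr1 (mulmxr (invmx P))).
  rewrite /= mulmxV // mulmxK // => /matrixP/(_ i i).
  by rewrite !mxE eqxx /= !mulr1n => <-.
(* [h] is [f] written in an eigenbasis of [B], so the diagonal matrix of eigenvalues fixes it. *)
pose h := lin_subst f (invmx P).
have hd : lin_subst h (diag_mx d) = h.
  rewrite /h lin_subst_mulmx -[in RHS]fB lin_subst_mulmx BE.
  by rewrite mulmxK.
have hh : h \is 4.-homog := dhomog_lin_subst _ f_quartic.
have nh : nonsingular h := nonsingular_lin_subst uV f_nonsing.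
have d1 : exists i, d 0 i != 1.
  apply: contrapT => /forallNP H; case/eqP: B1; rewrite BE.
  have -> : d = const_mx 1 by apply/rowP => i; rewrite mxE; apply/eqP/negPn/negP.
  by rewrite diag_const_mx mulmx1 mulVmx.
(* Nonsingularity at the i-th vertex puts some [X_i^3 X_j] into [h]; invariance gives
   [d_i^3 d_j = 1], hence [d_j = d_i^4] because [d_i^7 = 1]. *)
have d4 i : exists j, d 0 j = d 0 i ^+ 4.
  have [j hj] := nonsingular_vertex i nh hh; exists j.
  have := lin_subst_diag_fixed hd hj.
  rewrite -(mevalX (d 0)) mpolyXD -mpolyXn mevalM rmorphXn /= !mevalXU => e.
  by rewrite -[LHS]mul1r -(d7 i) -[RHS]mulr1 -e; ring.
have [s [w [w1 [e0 e1 e2 e3]]]] := weights_classification d7 d1 d4.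
have w7 : w ^+ 7 = 1 by rewrite -e0.
pose d' : 'rV[k]_4 := \row_i d 0 (s i).
pose S : 'M[k]_4 := invmx (perm_mx s).
have uS : S \in unitmx by rewrite unitmx_inv unitmx_perm.
pose g := lin_subst h S.
have SD : S *m diag_mx d' = diag_mx d *m S.
  have sd : diag_mx d' *m perm_mx s = perm_mx s *m diag_mx d.
    by rewrite mul_diag_mx -row_permE; apply/matrixP => i j; rewrite !mxE mulr_natr.
  have us := unitmx_perm k s.
  by rewrite -[LHS](mulmxK us) -(mulmxA S) sd mulmxA mulVmx // mul1mx.
have gd : lin_subst g (diag_mx d') = g by rewrite /g lin_subst_mulmx SD -lin_subst_mulmx hd.
have hg : g \is 4.-homog := dhomog_lin_subst _ hh.
have ng : nonsingular g := nonsingular_lin_subst uS nh.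
have [D0 D1 D2] : [/\ d' 0 o0 = w, d' 0 o1 = w ^+ 4 & d' 0 o2 = w ^+ 2] by rewrite !mxE.
have D3 : d' 0 o3 = 1.
  have D3w := last_weight_neq hg ng w1 w7 gd D0 D1 D2.
  by case: e3 => e3; [rewrite mxE | case: D3w; rewrite mxE].
have [a [b [c [e [q [gE [a0 b0 c0 e0']]]]]]] :=
  fixed_weighted_quartic hg ng w1 w7 gd D0 D1 D2 D3.
have [D uD [l Dl]] := weighted_quartic_rescale q a0 b0 c0 e0'.
exists l.
  by apply: nonsingular_quartic_family; rewrite // -Dl -gE; apply: nonsingular_lin_subst.
(* The total change of coordinates: eigenbasis, reordering of the eigenvalues, diagonal
   rescaling. *)
have uT : invmx P *m S *m D \in unitmx by rewrite !unitmx_mul uV uS uD.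
exists (MkGL uT), 1; rewrite ?oner_eq0 // scale1r -Dl -gE /g /h /=.
by rewrite !lin_subst_mulmx !mulmxA.
Qed.
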